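(* Let $n\ge 1$, $\beta>0$ and $c\in\mathbb{R}$. Then for every $f\in C_0^\infty(\mathbb{R}^{n+1})$, $$\beta\,\big\|e^{\beta(ct+|x|^2)}f\big\|_{L^2_{x,t}}+\beta^{\frac12}\,\big\|e^{\beta(ct+|x|^2)}|\nabla f|\big\|_{L^2_{x,t}}\le\big\|e^{\beta(ct+|x|^2)}(i\partial_t+\Delta)f\big\|_{L^2_{x,t}}.$$
   Context: Points of $\mathbb{R}^{n+1}$ are written $(x,t)$ with $x\in\mathbb{R}^n$ and $t\in\mathbb{R}$. $\nabla$ and $\Delta$ denote the gradient and Laplacian in the space variable $x$ only. $C_0^\infty(\mathbb{R}^{n+1})$ is the space of smooth, compactly supported, complex-valued functions on $\mathbb{R}^{n+1}$, and $\|\cdot\|_{L^2_{x,t}}$ is the norm of $L^2(\mathbb{R}^{n+1})$ with respect to Lebesgue measure $dx\,dt$. *)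

(* Defs.v *)
From HB Require Import structures.
From mathcomp Require Import all_boot all_order all_algebra complex.
From mathcomp Require Import all_classical all_reals all_analysis.

Set Implicit Arguments.
Unset Strict Implicit.
Unset Printing Implicit Defensive.
Import Order.TTheory GRing.Theory Num.Theory.
Import numFieldNormedType.Exports.
Local Open Scope classical_set_scope.
Local Open Scope ring_scope.

(** The space R^n x R is ['rV[R]_n * R], with its product topology.  Row
    vectors get the sigma-algebra generated by the coordinates, as tuples do in
    the library; over [R : realType] it is the Borel sigma-algebra. *)

Definition measure_rV_display : measure_display -> measure_display.
Proof. exact. Qed.

Section measurable_rV.
Context {d} {T : measurableType d} (n : nat).

Let coords : 'I_n -> 'rV[T]_n -> T := fun i x => x ord0 i.

Let rV_set0 : g_sigma_preimage coords set0.
Proof. exact: sigma_algebra0. Qed.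

Let rV_setC A : g_sigma_preimage coords A -> g_sigma_preimage coords (~` A).
Proof. exact: sigma_algebraC. Qed.

Let rV_bigcup (F : (set 'rV[T]_n)^nat) :
  (forall i, g_sigma_preimage coords (F i)) ->
  g_sigma_preimage coords (\bigcup_i (F i)).
Proof. exact: sigma_algebra_bigcup. Qed.

HB.instance Definition _ := @isMeasurable.Build (measure_rV_display d)
  'rV[T]_n (g_sigma_preimage coords) rV_set0 rV_setC rV_bigcup.

End measurable_rV.

Section measurable_rV_lemmas.
Context d (T : measurableType d) (n : nat).

Lemma measurable_coord (i : 'I_n) :
  measurable_fun [set: 'rV[T]_n] (fun x => x ord0 i).
Proof.
move=> _ Y mY; rewrite setTI; apply: sub_sigma_algebra => /=.
rewrite -bigcup_seq/=; exists i => /=; first by rewrite mem_index_enum.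
by exists Y => //; rewrite setTI.
Qed.

Lemma measurable_fun_rVP d' (T' : measurableType d') (f : T' -> 'rV[T]_n) :
  (forall i, measurable_fun [set: T'] (fun x => f x ord0 i)) ->
  measurable_fun [set: T'] f.
Proof.
move=> mf _ A mA; rewrite setTI.
suff : (measurable : set (set 'rV[T]_n)) `<=` [set B | measurable (f @^-1` B)].
  by apply.
apply: smallest_sub => [|B].
  split => [|B mB|F mF] /=; first by rewrite preimage_set0.
  - by rewrite setTD preimage_setC; exact: measurableC.
  - by rewrite preimage_bigcup; exact: bigcupT_measurable.
rewrite -bigcup_seq => -[i _ [C mC <-]] /=; rewrite setTI.
by have := mf i measurableT _ mC; rewrite setTI.
Qed.

End measurable_rV_lemmas.

Section cons_rV.
Context d (T : measurableType d) (n : nat).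

Definition cons_rV (p : T * 'rV[T]_n) : 'rV[T]_n.+1 :=
  \row_i (if unlift ord0 i is Some j then p.2 ord0 j else p.1).

Definition uncons_rV (x : 'rV[T]_n.+1) : T * 'rV[T]_n :=
  (x ord0 ord0, \row_j x ord0 (lift ord0 j)).

Lemma cons_rVK : cancel cons_rV uncons_rV.
Proof.
case=> a v; rewrite /uncons_rV /cons_rV mxE unlift_none; congr pair.
by apply/rowP => j; rewrite !mxE liftK.
Qed.

Lemma uncons_rVK : cancel uncons_rV cons_rV.
Proof.
move=> x; apply/rowP => i; rewrite mxE.
by case: unliftP => [j ->|->] //=; rewrite mxE.
Qed.

Lemma measurable_cons_rV : measurable_fun setT cons_rV.
Proof.
apply: measurable_fun_rVP => i.
case: (unliftP ord0 i) => [j|] ->.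
  rewrite (_ : (fun _ => _) = (fun v : 'rV[T]_n => v ord0 j) \o snd).
    by apply: measurableT_comp; [exact: measurable_coord|exact: measurable_snd].
  by apply/funext => p; rewrite mxE liftK.
rewrite (_ : (fun _ => _) = fst); first exact: measurable_fst.
by apply/funext => p; rewrite mxE unlift_none.
Qed.

Lemma measurable_uncons_rV : measurable_fun setT uncons_rV.
Proof.
apply: measurable_fun_pair; first exact: measurable_coord.
apply: measurable_fun_rVP => j.
by under eq_fun do rewrite mxE; exact: measurable_coord.
Qed.

End cons_rV.

(** [lebesgue_measure] is declared on [measurableTypeR R], whose measurable
    structure is convertible, but not syntactically equal, to that of [R]. *)

Section lebesgue_R.
Context (R : realType).

Definition lebesgue_R : set R -> \bar R := @lebesgue_measure R.

HB.instance Definition _ := isMeasure.Build _ R R lebesgue_R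
  (measure0 (@lebesgue_measure R)) (measure_ge0 (@lebesgue_measure R))
  (@measure_semi_sigma_additive _ _ _ (@lebesgue_measure R)).

HB.instance Definition _ := Measure_isSigmaFinite.Build _ R R lebesgue_R
  (sigma_finiteT (@lebesgue_measure R)).

End lebesgue_R.

(** The instance of the library for products of sigma-finite measures is
    shadowed by the one for products of subprobabilities. *)

Lemma sigma_finite_product d1 d2 (T1 : measurableType d1)
    (T2 : measurableType d2) (R : realType)
    (m1 : {sigma_finite_measure set T1 -> \bar R})
    (m2 : {sigma_finite_measure set T2 -> \bar R}) :
  sigma_finite setT (m1 \x m2)%E.
Proof.
have /sigma_finiteP[F [TF ndF Foo]] := sigma_finiteT m1.
have /sigma_finiteP[G [TG ndG Goo]] := sigma_finiteT m2.
exists (fun n => F n `*` G n).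
  rewrite -setXTT TF TG predeqE => -[x y]; split.
    move=> [/= [n _ Fnx] [k _ Gky]]; exists (maxn n k) => //; split.
    - by move: x Fnx; exact/subsetPset/ndF/leq_maxl.
    - by move: y Gky; exact/subsetPset/ndG/leq_maxr.
  by move=> [n _ []/= ? ?]; split; exists n.
move=> k; have [? ?] := Foo k; have [? ?] := Goo k.
split; first exact: measurableX.
by rewrite product_measure1E// lte_mul_pinfty// ge0_fin_numE.
Qed.

Section lebesgue_cons.
Context (R : realType) (n : nat).
Variable mu : {sigma_finite_measure set 'rV[R]_n -> \bar R}.

Definition lebesgue_cons : set 'rV[R]_n.+1 -> \bar R :=
  pushforward (@lebesgue_R R \x mu)%E (@cons_rV _ R n).

Let lebesgue_cons0 : lebesgue_cons set0 = 0%E.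
Proof. by rewrite /lebesgue_cons /pushforward preimage_set0 measure0. Qed.

Let lebesgue_cons_ge0 A : (0 <= lebesgue_cons A)%E.
Proof. exact: (measure_ge0 (@lebesgue_R R \x mu)%E). Qed.

Let lebesgue_cons_sigma_additive : semi_sigma_additive lebesgue_cons.
Proof.
move=> F mF tF mUF; rewrite /lebesgue_cons /pushforward preimage_bigcup.
have mp B : measurable B -> measurable (@cons_rV _ R n @^-1` B).
  by move=> mB; rewrite -[X in measurable X]setTI; exact: measurable_cons_rV.
apply: measure_semi_sigma_additive => [i| |].
- exact: mp.
- apply/trivIsetP => i j _ _ ij; rewrite -preimage_setI.
  by move/trivIsetP : tF => /(_ i j I I ij) ->; rewrite preimage_set0.
- by rewrite -preimage_bigcup; exact: mp.
Qed.

HB.instance Definition _ := isMeasure.Build _ _ _ lebesgue_cons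
  lebesgue_cons0 lebesgue_cons_ge0 lebesgue_cons_sigma_additive.

Let lebesgue_cons_sigma_finite : sigma_finite setT lebesgue_cons.
Proof.
have [F FT Foo] := sigma_finite_product (@lebesgue_R R) mu.
exists (fun k => @uncons_rV _ R n @^-1` F k).
  by rewrite -preimage_bigcup -FT preimage_setT.
move=> k; have [mFk Fk] := Foo k; split.
  by rewrite -[X in measurable X]setTI; exact: measurable_uncons_rV.
rewrite /lebesgue_cons /pushforward -comp_preimage.
rewrite (_ : @uncons_rV _ R n \o _ = id) ?preimage_id//.
by apply/funext => p /=; rewrite cons_rVK.
Qed.

HB.instance Definition _ := Measure_isSigmaFinite.Build _ _ _ lebesgue_cons
  lebesgue_cons_sigma_finite.

End lebesgue_cons.

Fixpoint lebesgue_rV (R : realType) (n : nat) :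
    {sigma_finite_measure set 'rV[R]_n -> \bar R} :=
  if n is n'.+1 then lebesgue_cons (lebesgue_rV R n') else @dirac _ 'rV[R]_0 0 R.

Lemma lebesgue_rV_box (R : realType) (n : nat) (A : 'I_n -> set R) :
  (forall i, measurable (A i)) ->
  lebesgue_rV R n [set x : 'rV[R]_n | forall i, A i (x ord0 i)] =
  (\prod_(i < n) lebesgue_measure (A i))%E.
Proof.
elim: n A => [|n ih] A mA.
  by rewrite big_ord0 /= /dirac indicE mem_set// => -[].
rewrite big_ord_recl -ih//.
set B := [set x : 'rV[R]_n | forall i : 'I_n, _].
have mB : measurable B.
  rewrite (_ : B = \bigcap_(i in [set: 'I_n])
    ((fun x : 'rV[R]_n => x ord0 i) @^-1` A (lift ord0 i))).
    apply: fin_bigcap_measurable => [|i _]; first exact: finite_finset.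
    by rewrite -[X in measurable X]setTI; exact: measurable_coord.
  by apply/seteqP; split=> x /= Ax i => [_|]; exact: Ax.
rewrite -[lebesgue_measure (A ord0)]/(lebesgue_R (A ord0)).
rewrite -product_measure1E//= /lebesgue_cons /pushforward.
congr (product_measure1 _ _ _); apply/seteqP; split=> -[a v] /=.
  move=> Aav; split => [|i /=].
    by have := Aav ord0; rewrite mxE unlift_none.
  by have := Aav (lift ord0 i); rewrite mxE liftK.
by move=> [Aa Av] i; rewrite mxE; case: unliftP => [j|] -> //=; exact: Av.
Qed.

Section function_spaces.
Context (R : realType) (n : nat).
Local Notation space := ('rV[R]_n * R)%type.
Implicit Types (f : space -> R[i]) (p : space).

(** [Some i] is the direction of x_i, [None] the direction of t. *)
Definition axis (k : option 'I_n) : space :=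
  if k is Some i then (delta_mx ord0 i, 0) else (0, 1).

Definition smoothR (g : space -> R) : Prop :=
  forall s : seq (option 'I_n),
    let h := foldr (fun k g' => 'D_(axis k) g') g s in
    continuous h /\ forall k p, derivable h p (axis k).

(** [R[i]] carries no normed module structure over [R], so that derivatives
    of complex-valued functions are taken on real and imaginary parts. *)
Definition smooth f : Prop :=
  smoothR (fun p => complex.Re (f p)) /\ smoothR (fun p => complex.Im (f p)).

Definition test_function f : Prop :=
  smooth f /\ compact (closure [set p | f p != 0]).

Definition partial (k : option 'I_n) f : space -> R[i] := fun p =>
  Complex ('D_(axis k) (fun q => complex.Re (f q)) p)
          ('D_(axis k) (fun q => complex.Im (f q)) p).

Definition dt f := partial None f.

Definition laplacian f : space -> R[i] := fun p =>
  \sum_(i < n) partial (Some i) (partial (Some i) f) p.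

Definition grad_norm f : space -> R := fun p =>
  Num.sqrt (\sum_(i < n) Normc.normc (partial (Some i) f p) ^+ 2).

(** The norm of the library on ['rV[R]_n] is the sup norm. *)
Definition sqnorm (x : 'rV[R]_n) : R := \sum_(i < n) x ord0 i ^+ 2.

Definition L2norm f : \bar R :=
  Lnorm (lebesgue_rV R n \x @lebesgue_R R)%E 2%:E
    (fun p => (Normc.normc (f p))%:E).

End function_spaces.

(* Main.v *)
Require Import Defs.
From mathcomp Require Import all_boot all_order all_algebra complex.
From mathcomp Require Import all_classical all_reals all_analysis.
From mathcomp Require Import measurable_realfun ring lra.
Set Implicit Arguments.
Unset Strict Implicit.
Unset Printing Implicit Defensive.
Import Order.TTheory GRing.Theory Num.Theory.
Import numFieldNormedType.Exports.
Local Open Scope classical_set_scope.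
Local Open Scope ring_scope.

(** Let w = exp(beta (c t + |x|^2)) and g = w f.  Conjugating by the weight,
    w (i d_t + Delta) f = (S + A) g, where
      S = i d_t + Delta + 4 beta^2 |x|^2
    is symmetric and
      A = - 4 beta (x . grad + n/2) - i beta c
    is skew.  Expanding the square, the right-hand side of the inequality is,
    squared, |S g|^2 + |A g|^2 + 2 Re <S g, A g>, hence at least the cross
    term 2 Re <S g, A g> = <[S, A] g, g>.  The commutator is positive: since
    x . grad + n/2 generates the dilations, under which Delta and |x|^2 have
    degrees -2 and 2 and with which d_t commutes,
      2 Re <S g, A g> = 8 beta M,   M = |grad g|^2 + 4 beta^2 |x g|^2.
    This is [Int_commutator].

    Both terms on the left are controlled by M.  Expanding
    |grad g + 2 beta x g|^2 >= 0 and integrating by parts gives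
    M >= 2 beta n |g|^2 ([uncertainty]), and w grad f = grad g - 2 beta x g
    gives |w grad f|^2 <= 2 M ([Int_conj_grad2_le]).  Each of
    beta |w f| and beta^(1/2) |w grad f| is thus at most half of
    |w (i d_t + Delta) f| ([carleman], [sqrt_sum_le]).

    Everything rests on integration by parts for smooth functions supported in
    a compact set: [Int_D] says that a derivative has integral 0, by Fubini
    and the fundamental theorem of calculus on each line parallel to an axis.
    The commutation of x . grad with the partial derivatives also needs the
    symmetry of second derivatives ([derive_swap]). *)

(** * Borel measurability and integrability on R^n x R *)

Section measurability.
Context (R : realType) (n : nat).
Local Notation space := ('rV[R]_n * R)%type.

Definition cube (p : space) (e : R) : set space :=
  [set x : 'rV[R]_n | forall i, `]p.1 ord0 i - e, p.1 ord0 i + e[%classic (x ord0 i)]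
  `*` `]p.2 - e, p.2 + e[%classic.

Lemma measurable_box (A : 'I_n -> set R) : (forall i, measurable (A i)) ->
  measurable [set x : 'rV[R]_n | forall i, A i (x ord0 i)].
Proof.
move=> mA.
rewrite (_ : [set _ | _] = \bigcap_(i in [set: 'I_n])
    ((fun x : 'rV[R]_n => x ord0 i) @^-1` A i)).
  apply: fin_bigcap_measurable => [|i _]; first exact: finite_finset.
  by rewrite -[X in measurable X]setTI; exact: measurable_coord.
by apply/seteqP; split=> x /= Ax i => [_|]; exact: Ax.
Qed.

Lemma measurable_cube p e : measurable (cube p e).
Proof.
apply: measurableX; last exact: measurable_itv.
apply: (measurable_box (A := fun i => `]p.1 ord0 i - e, p.1 ord0 i + e[%classic)).
by move=> i; exact: measurable_itv.
Qed.

Definition ratpoint (q : 'rV[rat]_n * rat) : space :=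
  (\row_i ratr (q.1 ord0 i), ratr q.2).

(** The cubes with rational centre and half-side 1/(k+1) form a countable base,
    so the product sigma-algebra contains the open sets. *)
Lemma open_measurable_space (U : set space) : open U -> measurable U.
Proof.
move=> oU.
pose F (c : 'rV[rat]_n * rat * nat) : set space :=
  if `[< cube (ratpoint c.1) c.2.+1%:R^-1 `<=` U >]
  then cube (ratpoint c.1) c.2.+1%:R^-1 else set0.
suff -> : U = \bigcup_c F c.
  apply: countable_bigcupT_measurable; first exact: countableP.
  by move=> c; rewrite /F; case: ifP => _ //; exact: measurable_cube.
apply/seteqP; split => [p Up|p [c _]]; last first.
  by rewrite /F; case: ifP => // /asboolP; exact.
have /nbhs_ballP[e /= e0 eU] : nbhs p U by move: oU; rewrite openE; exact.
(* Twice the half-side must fit in e: once to reach the centre, once to leave it. *)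
have [k ke] : exists k : nat, k.+1%:R^-1 < e / 2.
  have [k _ /(_ k (leqnn k))] := near_infty_natSinv_lt (PosNum (divr_gt0 e0 (ltr0n R 2))).
  by exists k.
have [d dE] : exists d : R, d = k.+1%:R^-1 by exists k.+1%:R^-1.
have d0 : 0 < d by rewrite dE invr_gt0.
rewrite -dE in ke.
have approx (r : R) : exists q : rat, r - d < ratr q < r + d.
  have /rat_in_itvoo[q] : r - d < r + d by lra.
  by rewrite in_itv/=; exists q.
have [q [q1 q2]] : exists q : 'rV[rat]_n * rat,
    (forall i, p.1 ord0 i - d < ratr (q.1 ord0 i) < p.1 ord0 i + d) /\
    p.2 - d < ratr q.2 < p.2 + d.
  exists (\row_i xchoose (approx (p.1 ord0 i)), xchoose (approx p.2)).
  split=> [i|]; last exact: (xchooseP (approx p.2)).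
  by rewrite mxE; exact: (xchooseP (approx (p.1 ord0 i))).
exists (q, k) => //; rewrite /F /= -dE.
have -> : `[< cube (ratpoint q) d `<=` U >].
  apply/asboolP => -[x t] [/= xq tq]; apply: eU; split => /=.
    split => // i j; rewrite (ord1 i) -ball_normE /=.
    have := xq j; rewrite mxE in_itv/= => /andP[? ?]; have /andP[? ?] := q1 j.
    rewrite ltr_norml; apply/andP; split; lra.
  rewrite -ball_normE /=.
  move: tq; rewrite in_itv/= => /andP[? ?]; have /andP[? ?] := q2.
  rewrite ltr_norml; apply/andP; split; lra.
split => /= [i|]; rewrite ?mxE in_itv/=.
  by have /andP[? ?] := q1 i; apply/andP; split; lra.
by have /andP[? ?] := q2; apply/andP; split; lra.
Qed.

Lemma continuous_measurable_space (h : space -> R) :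
  continuous h -> measurable_fun setT h.
Proof.
move=> /continuousP ch; apply: (measurability _ (RGenOpens.measurableE R)) => //.
move=> _ [_ [a [b ->]] <-]; rewrite setTI.
by apply: open_measurable_space; apply: ch; exact: interval_open.
Qed.

End measurability.

Lemma integrable_bounded_support d (T : measurableType d) (R : realType)
    (mu : {measure set T -> \bar R}) (A : set T) (M : R) (h : T -> R) :
  measurable A -> (mu A < +oo)%E -> measurable_fun setT h ->
  (forall x, `|h x| <= M) -> (forall x, h x != 0 -> A x) ->
  mu.-integrable setT (EFin \o h).
Proof.
move=> mA Afin mh hM hA.
have -> : EFin \o h = (EFin \o h) \_ A.
  apply/funext => x; rewrite patchE; case: ifPn => // /negP xA /=.
  by have [->//|/hA /mem_set] := eqVneq (h x) 0.
apply/integrable_restrict => //; rewrite setTI.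
apply: measurable_bounded_integrable => //; first exact: measurable_funTS.
by exists M; split; rewrite ?num_real// => N MN x _ /=; rewrite (le_trans (hM x))// ltW.
Qed.

(** * Integrals that vanish along lines *)

Section integral_lines.
Context (R : realType).

Definition boxed n (r : R) (h : 'rV[R]_n -> R) :=
  forall x, h x != 0 -> forall i, `[- r, r]%classic (x ord0 i).

Lemma lebesgue_rV_box_lty n (r : R) :
  (lebesgue_rV R n [set x | forall i, `[(- r)%R, r]%classic (x ord0 i)] < +oo)%E.
Proof.
rewrite (@lebesgue_rV_box R n (fun=> `[(- r)%R, r]%classic))//.
rewrite ltey_eq; apply/orP; left.
apply: (big_ind (fun x : \bar R => x \is a fin_num)) => //.
  by move=> x y; exact: fin_numM.
move=> i _; rewrite lebesgue_measure_itv/=.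
by case: ifP.
Qed.

(** The measure on R^(n+1) is the image of a product measure; the uniform bound
    and the common box make the integrand integrable, as Fubini requires. *)
Lemma integral_rV_cons n (r M : R) (h : 'rV[R]_n.+1 -> R) :
  measurable_fun setT h -> (forall x, `|h x| <= M) -> boxed r h ->
  (\int[lebesgue_rV R n.+1]_x (h x)%:E =
   \int[@lebesgue_R R \x lebesgue_rV R n]_p (h (cons_rV p))%:E)%E /\
  (@lebesgue_R R \x lebesgue_rV R n)%E.-integrable setT
     (fun p => (h (cons_rV p))%:E).
Proof.
move=> mh hM hr.
have mc := @measurable_cons_rV _ R n.
have ic : (@lebesgue_R R \x lebesgue_rV R n)%E.-integrable setT
     (fun p => (h (cons_rV p))%:E).
  apply: (integrable_bounded_support (M := M) (h := h \o @cons_rV _ R n)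
    (A := @cons_rV _ R n @^-1` [set x | forall i, `[- r, r]%classic (x ord0 i)])).
  - rewrite -[X in measurable X]setTI; apply: mc => //.
    by apply: (measurable_box (A := fun i => `[- r, r]%classic)).
  - exact: (lebesgue_rV_box_lty n.+1 r).
  - exact: measurableT_comp.
  - by move=> x; exact: hM.
  - by move=> x; exact: hr.
split => //; rewrite /=.
rewrite [LHS](integral_pushforward mc)//.
by apply/measurable_EFinP.
Qed.

(** Fubini, by induction on the dimension: either the direction is the first
    coordinate, or the induction hypothesis applies to the slices.  Being
    bounded and supported in a box passes to every slice, whereas
    integrability would only pass to almost every slice. *)
Lemma integral_rV_lines n (i : 'I_n) (r M : R) (h : 'rV[R]_n -> R) :
  measurable_fun setT h -> (forall x, `|h x| <= M) -> boxed r h ->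
  (forall x, \int[@lebesgue_R R]_s (h (x + s *: delta_mx ord0 i))%:E = 0)%E ->
  (\int[lebesgue_rV R n]_x (h x)%:E = 0)%E.
Proof.
elim: n i h => [[]//|n ih] i h mh hM hr h0.
have [-> ic] := integral_rV_cons mh hM hr.
have consD (j : 'I_n) (s s' : R) (v : 'rV[R]_n) :
    cons_rV (s, v + s' *: delta_mx ord0 j) =
    cons_rV (s, v) + s' *: delta_mx ord0 (lift ord0 j) :> 'rV[R]_n.+1.
  apply/rowP => k; rewrite !mxE eqxx /=; case: unliftP => [l ->|->].
    by rewrite !mxE eqxx (inj_eq lift_inj).
  by rewrite mulr0 addr0.
have cons0D (s : R) (v : 'rV[R]_n) :
    cons_rV (s, v) = cons_rV (0 : R, v) + s *: delta_mx ord0 ord0 :> 'rV[R]_n.+1.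
  apply/rowP => k; rewrite !mxE eqxx /=; case: unliftP => [l ->|->].
    by rewrite mulr0 addr0.
  by rewrite eqxx mulr1 add0r.
case: (unliftP ord0 i) => [j|] ij.
  rewrite -integral12_prod_meas1//; apply: integral0_eq => s _.
  apply: (ih j (fun v => h (cons_rV (s, v)))).
  - apply: (measurableT_comp mh); apply: (measurableT_comp (@measurable_cons_rV _ R n)).
    exact: pair1_measurable.
  - by move=> x; exact: hM.
  - by move=> x /hr hx k; have := hx (lift ord0 k); rewrite mxE liftK.
  - move=> v; rewrite -[RHS](h0 (cons_rV (s, v))) ij.
    by apply: eq_integral => s' _; rewrite consD.
rewrite -integral21_prod_meas1//; apply: integral0_eq => v _.
rewrite -[RHS](h0 (cons_rV (0 : R, v))) ij.
by apply: eq_integral => s _; rewrite cons0D.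
Qed.

(** [lebesgue_R] and [lebesgue_measure] live on two measurable copies of [R];
    the identity transports one to the other. *)
Lemma integral_lebesgue_R (f : R -> \bar R) : measurable_fun setT f ->
  (@lebesgue_measure R).-integrable setT f ->
  (\int[@lebesgue_R R]_s f s = \int[@lebesgue_measure R]_s f s)%E.
Proof.
move=> mf intf.
have mid : measurable_fun setT (fun s : measurableTypeR R => (s : R)).
  by move=> _ A mA; rewrite setTI.
rewrite -[RHS]/(\int[@lebesgue_measure R]_(s in (fun s => s : R) @^-1` setT)
  (f \o (fun s : measurableTypeR R => (s : R))) s)%E.
by rewrite -(integral_pushforward mid).
Qed.

(** The integral runs over a segment whose end points lie outside the support,
    where the fundamental theorem of calculus gives 0 - 0. *)
Lemma integral_derive_compact (phi : R -> R) (r : R) :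
  (forall s, derivable phi s 1) -> continuous (fun s => 'D_1 phi s) ->
  (forall s, r < `|s| -> phi s = 0) ->
  (\int[@lebesgue_R R]_s ('D_1 phi s)%:E = 0)%E.
Proof.
move=> dphi cD phi0.
pose b := `|r| + 1.
have rb : r < b by rewrite /b; have := ler_norm r; lra.
have b0 : 0 < b by rewrite /b; have := normr_ge0 r; lra.
have D0 s : ~ `[- b, b]%classic s -> 'D_1 phi s = 0.
  move=> sb; have sr : r < `|s|.
    rewrite (lt_le_trans rb)// leNgt; apply/negP; rewrite ltr_norml => /andP[h1 h2].
    by apply: sb; rewrite /= in_itv/= !ltW.
  have nc : `|t| @[t --> s] --> `|s| := @norm_continuous R R^o s.
  have ns : \forall t \near s, phi t = cst 0 t.
    by near=> t; apply: phi0; near: t; exact: cvgr_gt nc _ sr.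
  by rewrite (near_eq_derive _ ns) derive_cst.
have DE : (fun s => ('D_1 phi s)%:E) = (fun s => ('D_1 phi s)%:E) \_ `[(- b)%R, b].
  apply/funext => s; rewrite patchE; case: ifPn => // /negP sb.
  by rewrite D0// => h; apply: sb; exact/mem_set.
rewrite integral_lebesgue_R; last 2 first.
- by apply/measurable_EFinP; exact: continuous_measurable_fun.
- rewrite DE; apply/integrable_restrict => //; rewrite setTI.
  apply: continuous_compact_integrable; first exact: segment_compact.
  exact: continuous_subspaceT.
have -> : (\int[@lebesgue_measure R]_s ('D_1 phi s)%:E =
   \int[@lebesgue_measure R]_(s in `[(- b)%R, b]) ('D_1 phi s)%:E)%E.
  by rewrite [RHS]integral_mkcond -DE.
rewrite (@continuous_FTC2 _ (fun s => 'D_1 phi s) phi).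
- by rewrite !phi0 ?subee// ?normrN (gtr0_norm b0).
- lra.
- exact: continuous_subspaceT.
- have cphi : continuous phi.
    by move=> s; apply: differentiable_continuous; apply/derivable1_diffP.
  split => //; first exact: cvg_at_right_filter (cphi _).
  exact: cvg_at_left_filter (cphi _).
- by move=> s _; rewrite derive1E.
Unshelve. all: by end_near.
Qed.

End integral_lines.

(** * Directional derivatives and their symmetry *)

Section lines.
Context (R : realType) (V : normedModType R).
Implicit Types (f : V -> R) (x v w : V).

(** A directional derivative is an ordinary derivative along a line; the two
    difference quotients agree before the limit is taken. *)
Lemma derive_lineE f x v s :
  (fun h : R => h^-1 *: (((fun t : R => f (t *: v + x)) \o shift s) (h *: 1) -
     f (s *: v + x))) =
  (fun h : R => h^-1 *: ((f \o shift (s *: v + x)) (h *: v) - f (s *: v + x))).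
Proof.
apply/funext => h /=; congr (_ *: (f _ - _)).
by rewrite scalerDl addrA [_%:A]mulr1.
Qed.

Lemma is_derive_line f x v s : derivable f (s *: v + x) v ->
  is_derive s 1 (fun t : R => f (t *: v + x)) ('D_v f (s *: v + x)).
Proof.
move=> df; split; first by rewrite /derivable derive_lineE.
by rewrite /derive derive_lineE.
Qed.

Lemma line_is_derive f x v (d : R) :
  is_derive (0 : R) 1 (fun t : R => f (t *: v + x)) d -> is_derive x v f d.
Proof.
move=> [df dE].
have E : (fun h : R => h^-1 *: (((fun t : R => f (t *: v + x)) \o shift 0) (h *: 1) -
     f (0 *: v + x))) = (fun h : R => h^-1 *: ((f \o shift x) (h *: v) - f x)).
  by rewrite derive_lineE scale0r add0r.
split; first by rewrite /derivable -E.
by rewrite -dE /derive -E.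
Qed.

(** The mean value theorem in the direction v, applied to the difference of f
    at two points w-apart, then in the direction w. *)
Lemma second_difference f p v w (e : R) : 0 < e ->
  (forall q, derivable f q v) -> (forall q, derivable ('D_v f) q w) ->
  exists2 st : R * R, (0 <= st.1 <= e) && (0 <= st.2 <= e) &
  (f (e *: v + (e *: w + p)) - f (e *: v + p)) - (f (e *: w + p) - f p) =
  e ^+ 2 * 'D_w ('D_v f) (st.2 *: w + (st.1 *: v + p)).
Proof.
move=> e0 dv dw.
have line_MVT (g dg : R -> R) : (forall s : R, is_derive s 1 g (dg s)) ->
    exists2 s, 0 <= s <= e & g e - g 0 = dg s * e.
  move=> gd.
  have cg : {within `[0, e], continuous g}.
    apply: continuous_subspaceT => s; apply: differentiable_continuous.
    by apply/derivable1_diffP; exact: (@ex_derive _ _ _ _ _ _ _ (gd s)).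
  have [s se E] := MVT_segment (ltW e0) (fun s _ => gd s) cg.
  by exists s; [move: se; rewrite in_itv|rewrite E subr0].
have [|s se E1] := line_MVT (fun s => f (s *: v + (e *: w + p)) - f (s *: v + p))
   (fun s => 'D_v f (s *: v + (e *: w + p)) - 'D_v f (s *: v + p)).
  by move=> s; apply: is_deriveB; exact: is_derive_line.
have [|t te E2] := line_MVT (fun t => 'D_v f (t *: w + (s *: v + p)))
   (fun t => 'D_w ('D_v f) (t *: w + (s *: v + p))).
  by move=> t; exact: is_derive_line.
exists (s, t) => /=; first by rewrite se.
move: E1 E2; rewrite !scale0r !add0r => -> E2.
by rewrite (addrCA (s *: v)) E2; ring.
Qed.

Lemma eq_of_close_values (a b : V -> R) p : continuous a -> continuous b ->
  (forall r, 0 < r -> exists q q', [/\ ball p r q, ball p r q' & a q = b q']) ->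
  a p = b p.
Proof.
move=> ca cb ab; apply/eqP/negPn/negP => neq.
pose d := `|a p - b p| / 2.
have d0 : 0 < d by rewrite divr_gt0// normr_gt0 subr_eq0.
have na : \forall q \near p, `|a p - a q| < d.
  by have /cvgrPdist_lt := ca p; exact.
have nb : \forall q \near p, `|b p - b q| < d.
  by have /cvgrPdist_lt := cb p; exact.
have /nbhs_ballP : nbhs p [set q | `|a p - a q| < d /\ `|b p - b q| < d].
  exact: filterI na nb.
move=> [r /= r0 rab].
have [q [q' [bq bq' E]]] := ab _ r0.
have [qa _] := rab _ bq; have [_ qb] := rab _ bq'.
have : `|a p - b p| < d + d.
  rewrite (_ : a p - b p = (a p - a q) - (b p - b q')); last by rewrite E; ring.
  by rewrite (le_lt_trans (ler_normB _ _))// ltrD.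
by rewrite /d -splitr ltxx.
Qed.

(** The second difference of f over a small parallelogram is symmetric in v and
    w, and is e^2 times either mixed derivative at some nearby point; both
    mixed derivatives being continuous, they agree. *)
Lemma derive_swap f v w :
  (forall q, derivable f q v) -> (forall q, derivable f q w) ->
  (forall q, derivable ('D_v f) q w) -> (forall q, derivable ('D_w f) q v) ->
  continuous ('D_w ('D_v f)) -> continuous ('D_v ('D_w f)) ->
  'D_w ('D_v f) = 'D_v ('D_w f).
Proof.
move=> dv dw dvw dwv cvw cwv; apply/funext => p.
apply: (eq_of_close_values (p := p) cvw cwv) => r r0.
pose c := `|v| + `|w| + 1.
have c0 : 0 < c by rewrite /c; have := normr_ge0 v; have := normr_ge0 w; lra.
(* With this side, the whole parallelogram lies in the ball of radius r. *)
pose e := r / c; have e0 : 0 < e by rewrite divr_gt0.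
have close s t : 0 <= s <= e -> 0 <= t <= e ->
    ball p r (t *: w + (s *: v + p)).
  move=> /andP[s0 se] /andP[t0 te]; rewrite -ball_normE /= distrC.
  rewrite addrA addrK (le_lt_trans (ler_normD _ _))// !normrZ !ger0_norm//.
  have -> : r = e * (`|v| + `|w|) + e.
    by rewrite -[X in _ + X]mulr1 -mulrDr /e divfK// gt_eqF.
  have := ler_wpM2r (normr_ge0 w) te; have := ler_wpM2r (normr_ge0 v) se.
  by rewrite mulrDr; lra.
have [[s t] /= /andP[se te] E1] := second_difference p e0 dv dvw.
have [[t' s'] /= /andP[te' se'] E2] := second_difference p e0 dw dwv.
exists (t *: w + (s *: v + p)), (t' *: w + (s' *: v + p)).
split; [exact: close|exact: close|].
rewrite (addrCA (s' *: v)) in E2.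
apply: (@mulfI _ (e ^+ 2)); first by rewrite expf_neq0// gt_eqF.
apply: (etrans (esym E1)); apply: etrans E2; rewrite (addrCA (e *: v)).
by move: (f _) (f _) (f _) (f _) => *; ring.
Qed.

Lemma is_derive_comp (phi : R -> R) f x v (a b : R) :
  is_derive (f x) 1 phi a -> is_derive x v f b -> is_derive x v (phi \o f) (a * b).
Proof.
move=> dphi [df dE]; apply: line_is_derive.
have dl := @is_derive_line f x v 0; rewrite !scale0r !add0r in dl.
rewrite -dE; apply: (@is_derive1_comp _ phi); last exact: dl.
by rewrite scale0r add0r.
Qed.

End lines.

(** * The algebra of smooth functions *)

Section smooth_closure.
Context (R : realType) (n : nat).
Local Notation space := ('rV[R]_n * R)%type.
Implicit Types (a b g h : space -> R) (k l : option 'I_n).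

Definition D k h : space -> R := 'D_(axis R k) h.

(** Indexed like [axis], so that the derivative of a coordinate is a Kronecker
    symbol, time included. *)
Definition coordinate k : space -> R :=
  fun p => if k is Some i then p.1 ord0 i else p.2.

(** Smoothness is the greatest predicate whose members are continuous, have
    partial derivatives everywhere, and have their partial derivatives among
    the members. *)
Lemma smooth_coind (P : (space -> R) -> Prop) h :
  (forall g, P g -> continuous g /\
     forall k, (forall p, derivable g p (axis R k)) /\ P (D k g)) ->
  P h -> smoothR h.
Proof.
move=> Pstep Ph s; rewrite /=.
have /Pstep[ch dh] : P (foldr (fun k g' => 'D_(axis R k) g') h s).
  by elim: s => //= k s /Pstep[_ /(_ k)[]].
by split => // k p; have [] := dh k.
Qed.

Lemma smooth_continuous h : smoothR h -> continuous h.
Proof. by move=> /(_ [::])[]. Qed.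

Lemma smooth_derivable h k p : smoothR h -> derivable h p (axis R k).
Proof. by move=> /(_ [::])[_]; exact. Qed.

Lemma smooth_D h k : smoothR h -> smoothR (D k h).
Proof. by move=> sh s; have := sh (rcons s k); rewrite foldr_rcons. Qed.

Lemma D_comm h k l : smoothR h -> D k (D l h) = D l (D k h).
Proof.
move=> sh; apply: derive_swap.
- by move=> q; exact: smooth_derivable.
- by move=> q; exact: smooth_derivable.
- by move=> q; apply: smooth_derivable; exact: smooth_D.
- by move=> q; apply: smooth_derivable; exact: smooth_D.
- by apply: smooth_continuous; do 2 apply: smooth_D.
- by apply: smooth_continuous; do 2 apply: smooth_D.
Qed.

Lemma D_add a b k : smoothR a -> smoothR b -> D k (a + b) = D k a + D k b.
Proof.
by move=> sa sb; apply/funext => p; apply: deriveD; exact: smooth_derivable.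
Qed.

Lemma D_mul a b k : smoothR a -> smoothR b -> D k (a * b) = D k a * b + a * D k b.
Proof.
move=> sa sb; apply/funext => p.
rewrite {1}/D deriveM; try exact: smooth_derivable.
rewrite -[RHS]/(D k a p * b p + a p * D k b p).
by rewrite addrC /GRing.scale /= [b p * _]mulrC.
Qed.

Lemma D_cst k (c : R) : D k (cst c) = cst 0.
Proof. by apply/funext => p; rewrite /D derive_cst. Qed.

Lemma is_derive_coord k l p :
  is_derive p (axis R k) (coordinate l) (k == l)%:R.
Proof.
apply: line_is_derive.
have -> : (fun t => coordinate l (t *: axis R k + p)) =
          (fun t : R => t * coordinate l (axis R k) + coordinate l p).
  by apply/funext => t; case: l => [i|] //=; rewrite !mxE.
have -> : (k == l)%:R = coordinate l (axis R k) :> R.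
  case: l k => [i|] [j|] //=; rewrite ?mxE//.
  by rewrite eqxx /= eq_sym.
apply: is_derive_eq; rewrite addr0 /GRing.scale /=.
by ring.
Qed.

Lemma D_coord k l : D k (coordinate l) = cst (k == l)%:R.
Proof.
by apply/funext => p; have [_] := is_derive_coord k l p.
Qed.

Lemma continuous_coord l : continuous (coordinate l).
Proof.
case: l => [i|] p /=; last exact: cvg_snd.
apply: (@continuous_comp _ _ _ (fun q : space => q.1) (fun x : 'rV[R]_n => x ord0 i)).
  exact: cvg_fst.
exact: coord_continuous.
Qed.

Lemma D_expR k a : smoothR a -> D k (expR \o a) = (expR \o a) * D k a.
Proof.
move=> sa; apply/funext => p; have da : derivable a p (axis R k) by exact: smooth_derivable.
by have [_] := is_derive_comp (is_derive_expR (a p)) (derivableP da).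
Qed.

(** All closure properties of smooth functions follow from one coinduction, on
    the expressions built from smooth functions: they are stable under partial
    derivatives by the product and chain rules, which replaces the formulas for
    the iterated derivatives of a product or of an exponential. *)
Inductive generated : (space -> R) -> Prop :=
  | generated_smooth a of smoothR a : generated a
  | generated_cst (c : R) : generated (cst c)
  | generated_coord k : generated (coordinate k)
  | generated_add a b of generated a & generated b : generated (a + b)
  | generated_mul a b of generated a & generated b : generated (a * b)
  | generated_exp a of generated a : generated (expR \o a).

Lemma generated_step g : generated g -> continuous g /\
  forall k, (forall p, derivable g p (axis R k)) /\ generated (D k g).
Proof.
elim=> {g} [a sa|c|l|a b ga [ca iha] gb [cb ihb]|a b ga [ca iha] gb [cb ihb]|a ga [ca iha]].
- split; first exact: smooth_continuous.
  move=> k; split=> [p|]; first exact: smooth_derivable.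
  by apply: generated_smooth; exact: smooth_D.
- split; first exact: cst_continuous.
  by move=> k; split => [p|]; rewrite ?D_cst; [exact: derivable_cst|exact: generated_cst].
- split; first exact: continuous_coord.
  move=> k; split => [p|]; last by rewrite D_coord; exact: generated_cst.
  by have [] := is_derive_coord k l p.
- split; first by move=> p; apply: cvgD; [exact: ca|exact: cb].
  move=> k; have [da Da] := iha k; have [db Db] := ihb k.
  split => [p|]; first exact: derivableD.
  have -> : D k (a + b) = D k a + D k b by apply/funext => p; exact: deriveD.
  exact: generated_add.
- split; first by move=> p; apply: cvgM; [exact: ca|exact: cb].
  move=> k; have [da Da] := iha k; have [db Db] := ihb k.
  split => [p|]; first exact: derivableM.
  have -> : D k (a * b) = a * D k b + b * D k a by apply/funext => p; exact: deriveM.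
  by apply: generated_add; exact: generated_mul.
- split.
    by move=> p; apply: continuous_comp; [exact: ca|exact: continuous_expR].
  move=> k; have [da Da] := iha k.
  have de p := is_derive_comp (is_derive_expR (a p)) (derivableP (da p)).
  split => [p|]; first by have [] := de p.
  have -> : D k (expR \o a) = (expR \o a) * D k a.
    by apply/funext => p; have [_] := de p.
  by apply: generated_mul => //; exact: generated_exp.
Qed.

Lemma smooth_generated g : generated g -> smoothR g.
Proof. exact: smooth_coind generated_step. Qed.

Lemma smooth_add a b : smoothR a -> smoothR b -> smoothR (a + b).
Proof. by move=> *; apply/smooth_generated/generated_add; exact: generated_smooth. Qed.

Lemma smooth_mul a b : smoothR a -> smoothR b -> smoothR (a * b).
Proof. by move=> *; apply/smooth_generated/generated_mul; exact: generated_smooth. Qed.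

Lemma smooth_cst (c : R) : smoothR (cst c : space -> R).
Proof. exact/smooth_generated/generated_cst. Qed.

Lemma smooth_coord k : smoothR (coordinate k).
Proof. exact/smooth_generated/generated_coord. Qed.

Lemma smooth_expR a : smoothR a -> smoothR (expR \o a).
Proof. by move=> *; apply/smooth_generated/generated_exp; exact: generated_smooth. Qed.

Lemma smooth_opp a : smoothR a -> smoothR (- a).
Proof.
move=> sa; have -> : - a = cst (-1) * a.
  by apply/funext => p; rewrite !fctE mulN1r.
exact: smooth_mul (smooth_cst _) sa.
Qed.

Lemma smooth_sum (J : Type) (r : seq J) (F : J -> space -> R) :
  (forall j, smoothR (F j)) -> smoothR (\sum_(j <- r) F j).
Proof.
move=> sF; elim: r => [|j r ih]; first by rewrite big_nil; exact: smooth_cst.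
by rewrite big_cons; apply: (smooth_add (sF j) ih).
Qed.

End smooth_closure.
Arguments smooth_cst {R n} c.
Arguments smooth_coord {R n} k.
Arguments smooth_D {R n h} k.
Arguments smooth_derivable {R n h} k p.

(** * Test functions, their integral, and integration by parts *)

Section test_functions.
Context (R : realType) (n : nat).
Local Notation space := ('rV[R]_n * R)%type.
Local Notation mu := (lebesgue_rV R n \x @lebesgue_R R)%E.
Implicit Types (a b h : space -> R) (k : option 'I_n).

Variable K : set space.
Hypotheses (Kcompact : compact K) (Kclosed : closed K).

(** Vanishing off one compact set K, fixed once and for all, makes the test
    functions a module over the smooth functions, stable under partial
    derivatives, on which the integral is linear. *)
Definition supported h := forall p, ~ K p -> h p = 0.

Definition testR h := smoothR h /\ supported h.

Lemma test_add a b : testR a -> testR b -> testR (a + b).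
Proof.
move=> [sa Ka] [sb Kb]; split; first exact: smooth_add.
by move=> p Kp; rewrite -[LHS]/(a p + b p) Ka// Kb// addr0.
Qed.

Lemma test_mulr a b : smoothR a -> testR b -> testR (a * b).
Proof.
move=> sa [sb Kb]; split; first exact: smooth_mul.
by move=> p Kp; rewrite -[LHS]/(a p * b p) Kb// mulr0.
Qed.

Lemma test_sum (J : Type) (r : seq J) (F : J -> space -> R) :
  (forall i, testR (F i)) -> testR (\sum_(i <- r) F i).
Proof.
move=> tF; elim: r => [|i r ih].
  by rewrite big_nil; split => //; exact: smooth_cst.
by rewrite big_cons; exact: test_add.
Qed.

Lemma test_D k h : testR h -> testR (D k h).
Proof.
move=> [sh Kh]; split; first exact: smooth_D.
move=> p Kp; rewrite /D.
have hp : \forall q \near p, h q = cst 0 q.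
  have : nbhs p (~` K) by apply: open_nbhs_nbhs; split => //; exact: closed_openC.
  by apply: filterS => q; exact: Kh.
by rewrite (near_eq_derive _ hp) derive_cst.
Qed.

Lemma compact_fun_bounded (h : space -> R) : continuous h ->
  exists M, forall p, K p -> `|h p| <= M.
Proof.
move=> ch; have : compact (h @` K).
  by apply: continuous_compact => //; exact: continuous_subspaceT.
move=> /(@compact_bounded R R^o)[M [_ hM]].
exists (M + 1) => p Kp; apply: (hM (M + 1)); first by rewrite ltrDl.
by exists p.
Qed.

(** The sum of the squares of the coordinates is continuous, hence bounded on K,
    and a real number is at most 1 plus its square in absolute value. *)
Lemma compact_coord_bounded : exists r, forall p, K p -> forall k, `|coordinate k p| <= r.
Proof.
have [|M hM] := compact_fun_bounded (h := \sum_k coordinate k * coordinate k).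
  by apply/smooth_continuous/smooth_sum => k; apply: smooth_mul; exact: smooth_coord.
exists (1 + M) => p Kp k; have := hM p Kp.
rewrite fct_sumE ger0_norm; last first.
  by apply: sumr_ge0 => l _; rewrite /= -expr2 sqr_ge0.
rewrite (bigD1 k)//= => HM.
have H0 : 0 <= \sum_(l | l != k) (coordinate l * coordinate l) p.
  by apply: sumr_ge0 => l _; rewrite /= -expr2 sqr_ge0.
have : coordinate k p * coordinate k p <= M by apply: le_trans HM; rewrite lerDl.
rewrite ler_norml => H; apply/andP; split; nra.
Qed.

Lemma supported_bounded h : continuous h -> supported h ->
  exists M, forall p, `|h p| <= M.
Proof.
move=> ch Kh; have [M hM] := compact_fun_bounded ch.
exists `|M| => p; have [Kp|Kp] := pselect (K p).
  by rewrite (le_trans (hM _ Kp))// ler_norm.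
by rewrite Kh// normr0.
Qed.

Lemma integrable_supported h : continuous h -> supported h ->
  mu.-integrable setT (EFin \o h).
Proof.
move=> ch Kh; have [M hM] := supported_bounded ch Kh.
have [r hr] := compact_coord_bounded.
pose A := [set x : 'rV[R]_n | forall i, `[(- r)%R, r]%classic (x ord0 i)].
have mA : measurable A by apply: (measurable_box (A := fun i => `[- r, r]%classic)).
have mI : measurable (`[- r, r]%classic : set R) by exact: measurable_itv.
apply: (integrable_bounded_support (A := A `*` `[- r, r]%classic) (M := M)) => //.
- exact: measurableX.
- have E := @product_measure1E _ _ _ _ _ (lebesgue_rV R n) (@lebesgue_R R) A _ mA mI.
  rewrite [X in (X < _)%E]E; apply: lte_mul_pinfty => //.
    by rewrite ge0_fin_numE//; exact: lebesgue_rV_box_lty.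
  rewrite -[X in (X < _)%E]/(lebesgue_measure `[(- r)%R, r]%classic) lebesgue_measure_itv/=.
  by case: ifP => // _; rewrite -EFinB ltry.
- exact: continuous_measurable_space.
- move=> p hp; have /hr Kp : K p by apply: contrapT => /Kh /eqP; exact/negP.
  split => [i|] /=; rewrite in_itv/= -ler_norml.
    exact: (Kp (Some i)).
  exact: (Kp None).
Qed.

Definition Int h : R := (\int[mu]_p h p)%R.

(** On every line parallel to the axis the integral of the derivative vanishes,
    so Fubini concludes. *)
Lemma Int_D k h : testR h -> Int (D k h) = 0.
Proof.
move=> th; have [sh Kh] := th; have [sD KD] := test_D k th.
have [r hr] := compact_coord_bounded.
have [M hM] := supported_bounded (smooth_continuous sD) KD.
have line p : (\int[@lebesgue_R R]_s (D k h (s *: axis R k + p))%:E = 0)%E.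
  pose phi (s : R) := h (s *: axis R k + p).
  have dphi (s : R) : is_derive s 1 phi (D k h (s *: axis R k + p)).
    by apply: is_derive_line; exact: smooth_derivable.
  have -> : (fun s => (D k h (s *: axis R k + p))%:E) = (fun s => ('D_1 phi s)%:E).
    by apply/funext => s; rewrite (@derive_val _ _ _ _ _ _ _ (dphi s)).
  (* The k-th coordinate at parameter s is s plus that of p. *)
  apply: (integral_derive_compact (r := r + `|coordinate k p|)) => [s|s|s rs].
  - exact: (@ex_derive _ _ _ _ _ _ _ (dphi s)).
  - have -> : 'D_1 phi = D k h \o (fun s => s *: axis R k + p).
      by apply/funext => t; rewrite (@derive_val _ _ _ _ _ _ _ (dphi t)).
    apply: continuous_comp; last exact: smooth_continuous.
    by apply: cvgD; [apply: cvgZl; exact: cvg_id|exact: cvg_cst].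
  - apply: Kh => /hr /(_ k).
    have -> : coordinate k (s *: axis R k + p) = s + coordinate k p.
      by case: k {th sD KD hM phi dphi rs} => [i|] /=; rewrite ?mxE ?eqxx /GRing.scale/= mulr1.
    move=> src; have := ler_normB (s + coordinate k p) (coordinate k p).
    rewrite addrK; lra.
have iD := integrable_supported (smooth_continuous sD) KD.
rewrite /Int /Rintegral [X in fine X](_ : _ = 0%E)//.
(* The outer integral is over t for a space direction, over x for the time. *)
case: k line sD KD hM iD {th} => [i|] line sD KD hM iD.
  rewrite -integral21_prod_meas1//; apply: integral0_eq => t _.
  apply: (integral_rV_lines (i := i) (r := r) (M := M) (h := fun x => D (Some i) h (x, t))).
  - by apply: measurable_fun_pair1; apply: continuous_measurable_space; exact: smooth_continuous.
  - by move=> x; exact: hM.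
  - move=> x hx j; rewrite /= in_itv/= -ler_norml.
    have /hr Kp : K (x, t) by apply: contrapT => /KD /eqP; exact/negP.
    exact: (Kp (Some j)).
  - move=> x; rewrite -[RHS](line (x, t)); apply: eq_integral => s _.
    congr (D _ _ _)%:E; rewrite /axis; congr pair; first by rewrite addrC.
    by rewrite /= [s *: _]mulr0 add0r.
rewrite -integral12_prod_meas1//; apply: integral0_eq => x _.
rewrite -[RHS](line (x, 0)); apply: eq_integral => s _.
congr (D _ _ _)%:E; rewrite /axis; congr pair; first by rewrite /= scaler0 add0r.
by rewrite /= [s *: _]mulr1 addr0.
Qed.

Lemma Int_add a b : testR a -> testR b -> Int (a + b) = Int a + Int b.
Proof.
move=> [sa Ka] [sb Kb]; apply: RintegralD => //.
  by apply: integrable_supported => //; exact: smooth_continuous.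
by apply: integrable_supported => //; exact: smooth_continuous.
Qed.

Lemma Int_scale (c : R) a : testR a -> Int (cst c * a) = c * Int a.
Proof.
move=> [sa Ka]; apply: RintegralZl => //.
by apply: integrable_supported => //; exact: smooth_continuous.
Qed.

Lemma Int_ge0 a : (forall p, 0 <= a p) -> 0 <= Int a.
Proof. by move=> a0; apply: Rintegral_ge0 => p _; exact: a0. Qed.

Lemma Int_le a b : testR a -> testR b -> (forall p, a p <= b p) -> Int a <= Int b.
Proof.
move=> [sa Ka] [sb Kb] ab; apply: le_Rintegral => //.
  by apply: integrable_supported => //; exact: smooth_continuous.
by apply: integrable_supported => //; exact: smooth_continuous.
Qed.

Lemma Int_sum (J : Type) (r : seq J) (F : J -> space -> R) :
  (forall i, testR (F i)) -> Int (\sum_(i <- r) F i) = \sum_(i <- r) Int (F i).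
Proof.
move=> tF; elim: r => [|j r ih].
  by rewrite !big_nil; exact: (congr1 fine (integral0 _ _)).
by rewrite !big_cons Int_add ?ih//; exact: test_sum.
Qed.

Lemma Int_by_parts k a b : smoothR a -> testR b -> Int (D k a * b) = - Int (a * D k b).
Proof.
move=> sa tb; have [sb _] := tb; apply/eqP; rewrite -addr_eq0 -Int_add.
- by apply/eqP; rewrite -(D_mul k sa sb); exact: (Int_D k (test_mulr sa tb)).
- by apply: test_mulr tb; exact: smooth_D.
- by apply: test_mulr sa _; exact: test_D.
Qed.

Lemma test_mull a b : testR a -> smoothR b -> testR (a * b).
Proof. by move=> ta sb; rewrite mulrC; exact: test_mulr sb ta. Qed.

Lemma test_opp a : testR a -> testR (- a).
Proof.
move=> [sa Ka]; split; first exact: smooth_opp.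
by move=> p Kp; rewrite -[LHS]/(- a p) Ka// oppr0.
Qed.

End test_functions.
Arguments test_D {R n K} Kclosed k h.

(** * The commutator of the symmetric and skew parts *)

Section euler.
#[local] Opaque smoothR D Int.
Context (R : realType) (n : nat).
Local Notation space := ('rV[R]_n * R)%type.
Implicit Types (a b h u v : space -> R) (k : option 'I_n).

Variable K : set space.
Hypotheses (Kcompact : compact K) (Kclosed : closed K).
Local Notation testR := (@testR R n K).
Local Notation Int := (@Int R n).
Local Notation x_ i := (@coordinate R n (Some i)).
Local Notation D_ i := (@D R n (Some i)).
Local Notation Dt := (@D R n None).

Lemma D_sum (J : Type) (r : seq J) (F : J -> space -> R) k :
  (forall j, smoothR (F j)) -> D k (\sum_(j <- r) F j) = \sum_(j <- r) D k (F j).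
Proof.
move=> sF; elim: r => [|j r ih].
  rewrite !big_nil; exact: (@D_cst R n k 0).
by rewrite !big_cons (D_add _ (sF j) (smooth_sum r sF)) ih.
Qed.

Definition euler h : space -> R := \sum_(i < n) x_ i * D_ i h.
Definition lap h : space -> R := \sum_(i < n) D_ i (D_ i h).
Definition grad2 h : space -> R := \sum_(i < n) D_ i h * D_ i h.
Definition r2 : space -> R := \sum_(i < n) x_ i * x_ i.
(** The dilation generator: the shift by n/2 makes x . grad skew-symmetric. *)
Definition dil h : space -> R := euler h + cst (n%:R / 2) * h.

Lemma smooth_euler h : smoothR h -> smoothR (euler h).
Proof. by move=> sh; apply: smooth_sum => i; exact: smooth_mul (smooth_coord _) (smooth_D _ sh). Qed.

Lemma test_euler h : testR h -> testR (euler h).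
Proof.
move=> th; apply: test_sum => i.
exact: test_mulr (smooth_coord _) (test_D Kclosed _ _ th).
Qed.

Lemma smooth_r2 : smoothR r2.
Proof.
by apply: smooth_sum => i; exact: smooth_mul (smooth_coord _) (smooth_coord _).
Qed.

Lemma test_lap h : testR h -> testR (lap h).
Proof.
move=> th; apply: test_sum => i.
exact: (test_D Kclosed _ _ (test_D Kclosed _ _ th)).
Qed.

Lemma test_grad2 h : testR h -> testR (grad2 h).
Proof.
move=> th; apply: test_sum => i.
exact: test_mull (test_D Kclosed _ _ th) (smooth_D _ (proj1 th)).
Qed.

Lemma smooth_dil h : smoothR h -> smoothR (dil h).
Proof.
by move=> sh; exact: smooth_add (smooth_euler sh) (smooth_mul (smooth_cst _) sh).
Qed.

Lemma test_dil h : testR h -> testR (dil h).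
Proof.
by move=> th; exact: test_add (test_euler th) (test_mulr (smooth_cst _) th).
Qed.

(* Syntax-directed, because smoothness is itself a universally quantified
   statement, which the generic automation would open. *)
Ltac smooth_tac :=
  lazymatch goal with
  | |- forall _, _ => intro; smooth_tac
  | |- smoothR (_ * _) => refine (smooth_mul _ _); smooth_tac
  | |- smoothR (_ + _) => refine (smooth_add _ _); smooth_tac
  | |- smoothR (- _) => refine (smooth_opp _); smooth_tac
  | |- smoothR (cst _) => exact (smooth_cst _)
  | |- smoothR (coordinate _) => exact (smooth_coord _)
  | |- smoothR (D _ _) => refine (smooth_D _ _); smooth_tac
  | |- smoothR (euler _) => refine (smooth_euler _); smooth_tac
  | |- smoothR (dil _) => refine (smooth_dil _); smooth_tac
  | |- smoothR r2 => exact smooth_r2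
  | |- smoothR (lap _) => refine (proj1 (test_lap _)); assumption
  | |- smoothR (grad2 _) => refine (proj1 (test_grad2 _)); assumption
  | |- smoothR ?h => is_var h; first [assumption |
       match goal with th : testR h |- _ => exact (proj1 th) end]
  end.

Ltac test_tac :=
  lazymatch goal with
  | |- forall _, _ => intro; test_tac
  | |- testR (_ * _) =>
      first [refine (test_mulr _ _); [solve [smooth_tac]|solve [test_tac]]
            |refine (test_mull _ _); [solve [test_tac]|solve [smooth_tac]]]
  | |- testR (_ + _) => refine (test_add _ _); test_tac
  | |- testR (- _) => refine (test_opp _); test_tac
  | |- testR (D _ _) => refine (test_D Kclosed _ _ _); test_tac
  | |- testR (euler _) => refine (test_euler _); test_tac
  | |- testR (dil _) => refine (test_dil _); test_tac
  | |- testR (lap _) => refine (test_lap _); test_tac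
  | |- testR (grad2 _) => refine (test_grad2 _); test_tac
  | |- testR ?h => is_var h; assumption
  end.

Ltac reg := solve [smooth_tac | test_tac].

Lemma D_coord_mul k i h : smoothR h ->
  D k (x_ i * h) = cst (k == Some i)%:R * h + x_ i * D k h.
Proof. by move=> sh; rewrite (D_mul k (smooth_coord (Some i)) sh) D_coord. Qed.

Lemma D_cst_mul k (r : R) h : smoothR h -> D k (cst r * h) = cst r * D k h.
Proof.
move=> sh; rewrite (D_mul k (smooth_cst r) sh) D_cst.
by rewrite (_ : cst 0 = 0 :> (space -> R))// mul0r add0r.
Qed.

Lemma euler_mul a b : smoothR a -> smoothR b ->
  euler (a * b) = euler a * b + a * euler b.
Proof.
move=> sa sb; rewrite /euler mulr_suml mulr_sumr -big_split /=.
by apply: eq_bigr => i _; rewrite (D_mul _ sa sb); ring.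
Qed.

Lemma Dt_euler h : smoothR h -> Dt (euler h) = euler (Dt h).
Proof.
move=> sh; rewrite /euler D_sum; last by reg.
apply: eq_bigr => i _; rewrite D_coord_mul; last by reg.
rewrite (D_comm None (Some i) sh) /=.
by rewrite (_ : cst 0 = 0 :> (space -> R))// mul0r add0r.
Qed.

(** The extra term comes from differentiating the coefficient x_i of x . grad. *)
Lemma D_euler i h : smoothR h -> D_ i (euler h) = euler (D_ i h) + D_ i h.
Proof.
move=> sh; rewrite /euler D_sum; last by reg.
rewrite addrC (eq_bigr (fun j => cst (Some i == Some j)%:R * D_ j h + x_ j * D_ j (D_ i h))).
  rewrite big_split /=; congr (_ + _).
  rewrite (bigD1 i)//= big1 ?addr0.
    by rewrite eqxx (_ : cst 1 = 1 :> (space -> R))// mul1r.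
  move=> j ji; rewrite (_ : Some i == Some j = false).
    by rewrite (_ : cst 0 = 0 :> (space -> R))// mul0r.
  by apply/negbTE; rewrite eq_sym.
move=> j _; rewrite D_coord_mul; last by reg.
by rewrite (D_comm (Some i) (Some j) sh).
Qed.

(** The divergence of the field x is n. *)
Lemma Int_euler a b : smoothR a -> testR b ->
  Int (euler a * b) = - Int (a * euler b) - n%:R * Int (a * b).
Proof.
move=> sa tb; have sb := proj1 tb.
have E i : Int (x_ i * D_ i a * b) = - Int (a * (x_ i * D_ i b)) - Int (a * b).
  have -> : x_ i * D_ i a * b = D_ i a * (x_ i * b) by ring.
  rewrite (Int_by_parts Kcompact Kclosed); [|reg..].
  rewrite (D_coord_mul _ _ sb) eqxx -opprD; congr (- _).
  rewrite -(Int_add Kcompact); [|reg..].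
  by congr Int; rewrite (_ : cst 1 = 1 :> (space -> R))//; ring.
rewrite /euler mulr_suml (Int_sum Kcompact); last by reg.
rewrite mulr_sumr (Int_sum Kcompact); last by reg.
under eq_bigr do rewrite E.
by rewrite big_split /= !sumrN sumr_const card_ord mulr_natl.
Qed.

Lemma dil_skew a b : smoothR a -> testR b -> Int (dil a * b) = - Int (a * dil b).
Proof.
move=> sa tb; have sb := proj1 tb.
have -> : dil a * b = euler a * b + cst (n%:R / 2) * (a * b) by rewrite /dil; ring.
have -> : a * dil b = a * euler b + cst (n%:R / 2) * (a * b) by rewrite /dil; ring.
rewrite !(Int_add Kcompact) ?(Int_scale Kcompact); [|reg..].
by rewrite Int_euler//; field.
Qed.

Lemma dil_self a : testR a -> Int (a * dil a) = 0.
Proof.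
move=> ta; have := dil_skew (proj1 ta) ta; rewrite (mulrC (dil a)); lra.
Qed.

Lemma Dt_dil h : smoothR h -> Dt (dil h) = dil (Dt h).
Proof.
move=> sh; rewrite /dil D_add; [|reg..].
by rewrite Dt_euler// D_cst_mul.
Qed.

Lemma D_dil i h : smoothR h -> D_ i (dil h) = dil (D_ i h) + D_ i h.
Proof.
move=> sh; rewrite /dil D_add; [|reg..].
by rewrite D_euler// D_cst_mul//; ring.
Qed.

Lemma euler_r2 : euler r2 = cst 2 * r2.
Proof.
rewrite /euler /r2 mulr_sumr; apply: eq_bigr => i _.
rewrite D_sum; last by reg.
rewrite (bigD1 i)//= big1 => [|j ji].
  rewrite D_coord_mul; last by reg.
  rewrite D_coord eqxx (_ : cst 1 = 1 :> (space -> R))//.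
  by rewrite (_ : cst 2 = 2 :> (space -> R))//; ring.
rewrite D_coord_mul; last by reg.
rewrite D_coord (_ : Some i == Some j = false); last first.
  by apply/negbTE; rewrite eq_sym.
by rewrite (_ : cst 0 = 0 :> (space -> R))//; ring.
Qed.

Lemma Int_lap u v : testR u -> testR v ->
  Int (lap u * v) = - \sum_(i < n) Int (D_ i u * D_ i v).
Proof.
move=> tu tv; have su := proj1 tu.
rewrite /lap mulr_suml (Int_sum Kcompact); last by reg.
rewrite -sumrN; apply: eq_bigr => i _.
by apply: (Int_by_parts Kcompact Kclosed); reg.
Qed.

(** Integrating by parts once, the commutator of the dilation generator with each
    derivative leaves the square of the derivative, and skewness kills the rest. *)
Lemma Int_lap_dil u : testR u -> Int (lap u * dil u) = - Int (grad2 u).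
Proof.
move=> tu; have su := proj1 tu.
rewrite (Int_lap tu (test_dil tu)) /grad2 (Int_sum Kcompact); last by reg.
apply: congr1; apply: eq_bigr => i _.
rewrite (D_dil _ su) mulrDr (Int_add Kcompact); [|reg..].
by rewrite (dil_self (test_D Kclosed _ _ tu)) add0r.
Qed.

(** |x|^2 is homogeneous of degree 2, so moving the generator to the other factor
    gives the same integral with the opposite sign, plus twice the
    right-hand side. *)
Lemma Int_r2_dil u : testR u -> Int (r2 * u * dil u) = - Int (r2 * (u * u)).
Proof.
move=> tu; have su := proj1 tu.
have H : Int (dil u * (r2 * u)) = - Int (u * dil (r2 * u)).
  by apply: dil_skew; reg.
have E : u * dil (r2 * u) = cst 2 * (r2 * (u * u)) + r2 * u * dil u.
  by rewrite /dil euler_mul ?euler_r2; [ring|reg..].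
rewrite E (Int_add Kcompact) ?(Int_scale Kcompact) in H;
  [|reg..].
by rewrite (mulrC (dil u)) in H; lra.
Qed.

Lemma Int_Dt_dil u v : testR u -> testR v -> Int (Dt v * dil u) = Int (Dt u * dil v).
Proof.
move=> tu tv; have su := proj1 tu; have sv := proj1 tv.
rewrite mulrC dil_skew; [|reg..].
by rewrite -(Dt_dil sv) (Int_by_parts Kcompact Kclosed); [|reg..].
Qed.

Lemma Int_Dt_self u : testR u -> Int (Dt u * u) = 0.
Proof.
move=> tu; have := Int_by_parts Kcompact Kclosed None (proj1 tu) tu.
rewrite (mulrC u); lra.
Qed.

Lemma Int_lap_sym u v : testR u -> testR v -> Int (lap u * v) = Int (lap v * u).
Proof.
move=> tu tv; apply: (etrans (Int_lap tu tv)); apply: (etrans _ (esym (Int_lap tv tu))).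
by apply: congr1; apply: eq_bigr => i _; rewrite mulrC.
Qed.

#[local] Opaque lap dil euler grad2 r2.

(** Stated with values, as are the next two lemmas, so that a long sum is
    integrated by applying them to its syntax tree. *)
Lemma Int_addE a b x y : testR a -> testR b -> Int a = x -> Int b = y ->
  Int (a + b) = x + y.
Proof. by move=> ta tb <- <-; exact: (Int_add Kcompact ta tb). Qed.

Lemma Int_scaleE (c : R) a x : testR a -> Int a = x -> Int (cst c * a) = c * x.
Proof. by move=> ta <-; exact: (Int_scale Kcompact c ta). Qed.

Lemma Int_oppE a x : testR a -> Int a = x -> Int (- a) = - x.
Proof.
move=> ta Ia; have -> : - a = cst (-1) * a.
  by apply/funext => p; rewrite !fctE mulN1r.
by rewrite (Int_scaleE (-1) ta Ia) mulN1r.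
Qed.

(** With al = 4 beta^2, ga = - 4 beta and de = beta c this is Re <S g, A g> for
    g = u + i v.  The time derivative commutes with the skew part and the
    constant de commutes with everything, so their terms cancel in pairs; what
    remains comes from the Laplacian and from |x|^2. *)
Lemma Int_commutator u v (al ga de : R) : testR u -> testR v ->
  Int ((lap u - Dt v + cst al * (r2 * u)) * (cst ga * dil u + cst de * v) +
     (lap v + Dt u + cst al * (r2 * v)) * (cst ga * dil v - cst de * u)) =
  - ga * (Int (grad2 u) + Int (grad2 v) + al * (Int (r2 * (u * u)) + Int (r2 * (v * v)))).
Proof.
move=> tu tv; have su := proj1 tu; have sv := proj1 tv.
have -> : (lap u - Dt v + cst al * (r2 * u)) * (cst ga * dil u + cst de * v) +
     (lap v + Dt u + cst al * (r2 * v)) * (cst ga * dil v - cst de * u) =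
  cst ga * (lap u * dil u + lap v * dil v) +
  cst ga * (cst al * (r2 * u * dil u + r2 * v * dil v)) +
  cst ga * (Dt u * dil v + - (Dt v * dil u)) +
  cst de * (lap u * v + - (lap v * u)) +
  cst de * (- (Dt u * u) + - (Dt v * v)).
  move: (lap u) (lap v) (Dt u) (Dt v) (dil u) (dil v) (cst al) (cst ga) (cst de) r2.
  by move=> *; ring.
have H1 : Int (lap u * dil u + lap v * dil v) = - Int (grad2 u) + - Int (grad2 v).
  by apply: Int_addE; [reg|reg|exact: Int_lap_dil|exact: Int_lap_dil].
have H2 : Int (r2 * u * dil u + r2 * v * dil v) = - Int (r2 * (u * u)) + - Int (r2 * (v * v)).
  by apply: Int_addE; [reg|reg|exact: Int_r2_dil|exact: Int_r2_dil].
have H3 : Int (Dt u * dil v + - (Dt v * dil u)) = Int (Dt u * dil v) + - Int (Dt u * dil v).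
  by apply: Int_addE; [reg|reg|by []|apply: Int_oppE; [reg|exact: Int_Dt_dil]].
have H4 : Int (lap u * v + - (lap v * u)) = Int (lap u * v) + - Int (lap u * v).
  by apply: Int_addE; [reg|reg|by []|apply: Int_oppE; [reg|exact: Int_lap_sym]].
have H5 : Int (- (Dt u * u) + - (Dt v * v)) = - 0 + - 0.
  by apply: Int_addE; [reg|reg|apply: Int_oppE; [reg|exact: Int_Dt_self]..].
transitivity (ga * (- Int (grad2 u) + - Int (grad2 v)) +
   ga * (al * (- Int (r2 * (u * u)) + - Int (r2 * (v * v)))) +
   ga * (Int (Dt u * dil v) + - Int (Dt u * dil v)) +
   de * (Int (lap u * v) + - Int (lap u * v)) + de * (- 0 + - 0)); last first.
  move: (Int (grad2 u)) (Int (grad2 v)) (Int (r2 * (u * u))) (Int (r2 * (v * v))).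
  by move: (Int (Dt u * dil v)) (Int (lap u * v)) => *; ring.
apply: Int_addE; [reg|reg| |by apply: Int_scaleE; [reg|exact: H5]].
apply: Int_addE; [reg|reg| |by apply: Int_scaleE; [reg|exact: H4]].
apply: Int_addE; [reg|reg| |by apply: Int_scaleE; [reg|exact: H3]].
apply: Int_addE; [reg|reg|by apply: Int_scaleE; [reg|exact: H1]|].
by do 2 (apply: Int_scaleE; [reg|]).
Qed.

(** [conj_re] and [conj_im] are the real and imaginary parts of (S + A)(u + i v). *)
Definition conj_re (b c : R) u v : space -> R :=
  lap u - Dt v + cst (4 * b ^+ 2) * (r2 * u) +
  (cst (- 4 * b) * dil u + cst (b * c) * v).

Definition conj_im (b c : R) u v : space -> R :=
  lap v + Dt u + cst (4 * b ^+ 2) * (r2 * v) +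
  (cst (- 4 * b) * dil v - cst (b * c) * u).

(** The square of the length of w grad (h / w). *)
Definition conj_grad2 (b : R) h : space -> R := \sum_(i < n)
  (D_ i h - cst (2 * b) * (x_ i * h)) * (D_ i h - cst (2 * b) * (x_ i * h)).

Lemma test_conj_re (b c : R) u v : testR u -> testR v -> testR (conj_re b c u v).
Proof. by move=> tu tv; rewrite /conj_re; reg. Qed.

Lemma test_conj_im (b c : R) u v : testR u -> testR v -> testR (conj_im b c u v).
Proof. by move=> tu tv; rewrite /conj_im; reg. Qed.

Lemma test_conj_grad2 (b : R) h : testR h -> testR (conj_grad2 b h).
Proof. by move=> th; have sh := proj1 th; apply: test_sum; reg. Qed.

#[local] Transparent grad2 euler r2.

(** Integrate the square of grad u + 2 b x u; the cross term 4 b u (x . grad u)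
    integrates to - 2 b n u^2. *)
Lemma uncertainty u (b : R) : testR u ->
  2 * b * n%:R * Int (u * u) <= Int (grad2 u) + 4 * b ^+ 2 * Int (r2 * (u * u)).
Proof.
move=> tu; have su := proj1 tu.
have E : grad2 u + cst (4 * b) * (u * euler u) + cst (4 * b ^+ 2) * (r2 * (u * u)) =
  \sum_(i < n) (D_ i u + cst (2 * b) * (x_ i * u)) * (D_ i u + cst (2 * b) * (x_ i * u)).
  rewrite /grad2 /euler /r2 !(mulr_suml, mulr_sumr) -!big_split /=.
  apply: eq_bigr => i _; apply/funext => p; rewrite !fctE.
  by move: (D _ _ _) (x_ i p) => d x; ring.
have : 0 <= Int (grad2 u + cst (4 * b) * (u * euler u) + cst (4 * b ^+ 2) * (r2 * (u * u))).
  rewrite E; apply: Int_ge0 => p; rewrite fct_sumE; apply: sumr_ge0 => i _.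
  by rewrite fctE -expr2 sqr_ge0.
rewrite !(Int_add Kcompact) ?(Int_scale Kcompact); [|reg..].
have := Int_euler su tu; rewrite (mulrC (euler u)) => H.
have -> : Int (u * euler u) = - (n%:R / 2) * Int (u * u) by lra.
by rewrite !mulNr mulrA mulrA; lra.
Qed.

(** The square of a difference is at most twice the sum of the squares. *)
Lemma Int_conj_grad2_le u (b : R) : testR u ->
  Int (conj_grad2 b u) <= 2 * (Int (grad2 u) + 4 * b ^+ 2 * Int (r2 * (u * u))).
Proof.
move=> tu; have su := proj1 tu.
have -> : 2 * (Int (grad2 u) + 4 * b ^+ 2 * Int (r2 * (u * u))) =
    Int (cst 2 * (grad2 u + cst (4 * b ^+ 2) * (r2 * (u * u)))).
  by rewrite (Int_scale Kcompact) ?(Int_add Kcompact) ?(Int_scale Kcompact); [|reg..].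
apply: (Int_le Kcompact); [exact: test_conj_grad2|reg|].
have -> : cst 2 * (grad2 u + cst (4 * b ^+ 2) * (r2 * (u * u))) =
    \sum_(i < n) cst 2 * (D_ i u * D_ i u + cst (4 * b ^+ 2) * (x_ i * x_ i * (u * u))).
  by rewrite /grad2 /r2 mulr_suml mulr_sumr -big_split /= mulr_sumr.
move=> p; rewrite /conj_grad2 !fct_sumE.
apply: ler_sum => i _; rewrite !fctE.
move: (D _ _ _) (x_ i p) (u p) => d x y; rewrite -subr_ge0.
rewrite (_ : _ - _ = (d + 2 * b * (x * y)) ^+ 2); last by ring.
exact: sqr_ge0.
Qed.

Lemma Int_square_sum p q r s : testR p -> testR q -> testR r -> testR s ->
  2 * Int (p * q + r * s) <= Int ((p + q) * (p + q) + (r + s) * (r + s)).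
Proof.
move=> tp tq tr ts.
have [sp sq sr ss] : [/\ smoothR p, smoothR q, smoothR r & smoothR s].
  by split; [exact: proj1 tp|exact: proj1 tq|exact: proj1 tr|exact: proj1 ts].
have tpq : testR (p * q + r * s) by reg.
rewrite -(Int_scale Kcompact 2 tpq); apply: (Int_le Kcompact); [reg|reg|].
move=> z; rewrite !fctE -subr_ge0.
rewrite (_ : _ - _ = p z ^+ 2 + q z ^+ 2 + (r z ^+ 2 + s z ^+ 2)); last by ring.
by rewrite !addr_ge0// sqr_ge0.
Qed.

(** The cross term bounds the square from below by 8 b M, where M is the
    right-hand side of [uncertainty] summed over u and v.  The factors 4 leave
    one half of the norm for each of the two terms of the final inequality. *)
Lemma carleman u v (b c : R) : 0 < b -> (0 < n)%N -> testR u -> testR v ->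
  let re := conj_re b c u v in let im := conj_im b c u v in
  4 * b ^+ 2 * Int (u * u + v * v) <= Int (re * re + im * im) /\
  4 * b * Int (conj_grad2 b u + conj_grad2 b v) <= Int (re * re + im * im).
Proof.
move=> b0 n0 tu tv re im; have su := proj1 tu; have sv := proj1 tv.
pose M := Int (grad2 u) + 4 * b ^+ 2 * Int (r2 * (u * u)) +
          (Int (grad2 v) + 4 * b ^+ 2 * Int (r2 * (v * v))).
have lower : 8 * b * M <= Int (re * re + im * im).
  have HC := Int_commutator (4 * b ^+ 2) (- 4 * b) (b * c) tu tv.
  rewrite /re /im; apply: le_trans (Int_square_sum _ _ _ _); [|reg..].
  have E (x y z t : R) : 8 * b * (x + 4 * b ^+ 2 * z + (y + 4 * b ^+ 2 * t)) =
    2 * (- (- 4 * b) * (x + y + 4 * b ^+ 2 * (z + t))) by ring.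
  by rewrite HC /M E.
have M0 : 2 * b * n%:R * Int (u * u + v * v) <= M.
  rewrite (Int_add Kcompact); [|reg..]; rewrite mulrDr.
  by apply: lerD; exact: uncertainty.
have gM : Int (conj_grad2 b u + conj_grad2 b v) <= 2 * M.
  rewrite (Int_add Kcompact (test_conj_grad2 b tu) (test_conj_grad2 b tv)) /M mulrDr.
  by apply: lerD; exact: Int_conj_grad2_le.
have J0 : 0 <= Int (u * u + v * v).
  by apply: Int_ge0 => p; rewrite !fctE -!expr2 addr_ge0 ?sqr_ge0.
move: (Int (u * u + v * v)) (Int (conj_grad2 b u + conj_grad2 b v)) (Int _) M lower M0 gM J0.
move=> J G N M lower M0 gM J0; split; apply: le_trans lower; last first.
  have -> : 8 * b * M = 4 * b * (2 * M) by ring.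
  by apply: ler_wpM2l gM; lra.
have n1 : 1 <= n%:R :> R by rewrite ler1n.
have : 2 * b * J <= M.
  have bJ : 0 <= b * J by rewrite mulr_ge0// ltW.
  by apply: le_trans M0; have := ler_wpM2r bJ n1; lra.
nra.
Qed.

End euler.

(** * Conjugation by the weight *)

Section conjugation.
Context (R : realType) (n : nat).
Local Notation space := ('rV[R]_n * R)%type.
Local Notation mu := (lebesgue_rV R n \x @lebesgue_R R)%E.
Local Notation x_ i := (@coordinate R n (Some i)).
Local Notation D_ i := (@D R n (Some i)).
Local Notation Dt := (@D R n None).
Implicit Types (a h u v : space -> R).
#[local] Opaque smoothR D Int.

Lemma L2norm_sqrt_Int (K : set space) (F : space -> R[i]) h : compact K -> testR K h ->
  (forall p, Normc.normc (F p) ^+ 2 = h p) -> L2norm F = (Num.sqrt (Int h))%:E.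
Proof.
move=> Kc [sh Kh] Fh.
have ih := integrable_supported Kc (smooth_continuous sh) Kh.
rewrite /L2norm Lnorm.unlock.
have -> : (\int[mu]_x (`|(Normc.normc (F x))%:E| `^ 2) = (Int h)%:E)%E.
  transitivity (\int[mu]_x (h x)%:E)%E; last first.
    by rewrite -[RHS]/((fine _)%:E) fineK//; exact: integrable_fin_num.
  have n0 (z : R[i]) : 0 <= Normc.normc z by case: z => x y; exact: sqrtr_ge0.
  by apply: eq_integral => x _; rewrite /= -Fh ger0_norm// powR_mulrn.
transitivity ((Int h)%:E `^ 2^-1)%E; first by [].
rewrite poweR_EFin.
by rewrite powR12_sqrt//; apply: Int_ge0 => p; rewrite -Fh sqr_ge0.
Qed.

Variables b c : R.

Definition phase : space -> R := cst b * (cst c * coordinate None + @r2 R n).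
Definition weight : space -> R := expR \o phase.

Lemma weightE p : weight p = expR (b * (c * p.2 + sqnorm p.1)).
Proof.
by rewrite /weight /phase /r2 /= fct_sumE; congr (expR (_ * (_ + _))).
Qed.

Lemma smooth_phase : smoothR phase.
Proof.
exact: (smooth_mul (smooth_cst b) (smooth_add
  (smooth_mul (smooth_cst c) (smooth_coord None)) (@smooth_r2 R n))).
Qed.

Lemma smooth_weight : smoothR weight.
Proof. exact: smooth_expR smooth_phase. Qed.

Lemma D_r2 k : D k (@r2 R n) = if k is Some i then cst 2 * x_ i else cst 0.
Proof.
have sx i : smoothR (x_ i * x_ i) := smooth_mul (smooth_coord _) (smooth_coord _).
rewrite /r2 (D_sum _ _ sx).
have E i : D k (x_ i * x_ i) = cst (2 * (k == Some i)%:R) * x_ i.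
  rewrite (D_mul _ (smooth_coord _) (smooth_coord _)) D_coord.
  by apply/funext => p; rewrite !fctE; ring.
rewrite (eq_bigr (fun i => cst (2 * (k == Some i)%:R) * x_ i)) => [|i _]; last exact: E.
case: k {E} => [i|].
  rewrite (bigD1 i)//= big1 => [|j ji].
    by rewrite addr0 eqxx mulr1.
  rewrite (_ : Some i == Some j = false); last by apply/negbTE; rewrite eq_sym.
  by apply/funext => p; rewrite !fctE mulr0 mul0r.
by rewrite big1// => i _; apply/funext => p; rewrite !fctE mulr0 mul0r.
Qed.

Lemma D_phase k : D k phase = if k is Some i then cst (2 * b) * x_ i else cst (b * c).
Proof.
have sc := smooth_mul (smooth_cst c) (smooth_coord (R := R) (n := n) None).
rewrite /phase (D_cst_mul _ _ (smooth_add sc (@smooth_r2 R n))).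
rewrite (D_add _ sc (@smooth_r2 R n)) (D_cst_mul _ _ (smooth_coord _)) D_coord D_r2.
by case: k => [i|]; apply/funext => p; rewrite !fctE /=; ring.
Qed.

Lemma D_weight_mul k a : smoothR a ->
  weight * D k a = D k (weight * a) - D k phase * (weight * a).
Proof.
move=> sa; rewrite (D_mul _ smooth_weight sa) (D_expR _ smooth_phase) -/weight.
ring.
Qed.

Lemma weight_D i a : smoothR a ->
  weight * D_ i a = D_ i (weight * a) - cst (2 * b) * (x_ i * (weight * a)).
Proof. by move=> sa; rewrite (D_weight_mul _ sa) D_phase -mulrA. Qed.

Lemma weight_Dt a : smoothR a ->
  weight * Dt a = Dt (weight * a) - cst (b * c) * (weight * a).
Proof. by move=> sa; rewrite (D_weight_mul _ sa) D_phase. Qed.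

Lemma weight_D2 i a : smoothR a ->
  weight * D_ i (D_ i a) = D_ i (D_ i (weight * a)) +
    cst (4 * b ^+ 2) * (x_ i * x_ i * (weight * a)) +
    (cst (- 4 * b) * (x_ i * D_ i (weight * a)) - cst (2 * b) * (weight * a)).
Proof.
move=> sa; have swa := smooth_mul smooth_weight sa.
rewrite (weight_D _ (smooth_D _ sa)) (weight_D _ sa).
have sxw := smooth_mul (smooth_coord (Some i)) swa.
have -> : D_ i (weight * a) - cst (2 * b) * (x_ i * (weight * a)) =
    D_ i (weight * a) + cst (- 2 * b) * (x_ i * (weight * a)).
  by apply/funext => p; rewrite !fctE; ring.
rewrite (D_add _ (smooth_D _ swa) (smooth_mul (smooth_cst _) sxw)).
rewrite (D_cst_mul _ _ sxw) (D_coord_mul _ _ swa) eqxx.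
by move: (weight * a) => u; apply/funext => p; rewrite !fctE /=; ring.
Qed.

(** The conjugated Laplacian, already split into its symmetric part and its
    multiple of the dilation generator; the n terms - 2 b of [weight_D2] supply
    the shift by n/2. *)
Lemma weight_lap a : smoothR a ->
  weight * lap a = lap (weight * a) + cst (4 * b ^+ 2) * (@r2 R n * (weight * a)) +
    cst (- 4 * b) * dil (weight * a).
Proof.
move=> sa; rewrite /lap mulr_sumr.
rewrite (eq_bigr _ (fun i _ => weight_D2 i sa)) !big_split /=.
rewrite -[in RHS]addrA -[in LHS]addrA; congr (_ + _); congr (_ + _).
  by rewrite /r2 mulr_suml mulr_sumr.
rewrite /dil /euler mulrDr mulr_sumr; congr (_ + _).
apply/funext => p; rewrite fct_sumE sumr_const card_ord -mulr_natl !fctE.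
by field.
Qed.

End conjugation.

(** * Real and imaginary parts *)

Section complex_parts.
Context (R : realType) (n : nat).
Local Notation space := ('rV[R]_n * R)%type.
Implicit Types (f : space -> R[i]) (p : space).

Lemma sqr_normc (x y : R) : Normc.normc (Complex x y) ^+ 2 = x ^+ 2 + y ^+ 2.
Proof. by rewrite /= sqr_sqrtr// addr_ge0 ?sqr_ge0. Qed.

Lemma sum_Complex (J : Type) (r : seq J) (a b : J -> R) :
  \sum_(j <- r) Complex (a j) (b j) = Complex (\sum_(j <- r) a j) (\sum_(j <- r) b j).
Proof. by elim: r => [|j r ih]; rewrite ?big_nil// !big_cons ih. Qed.

Lemma real_mul_Complex (w x y : R) : (w%:C * Complex x y)%C = Complex (w * x) (w * y).
Proof. by rewrite /GRing.mul /= !mul0r subr0 addr0. Qed.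

Lemma laplacianE f p : laplacian f p =
  Complex (lap (fun q => complex.Re (f q)) p) (lap (fun q => complex.Im (f q)) p).
Proof.
have E i : partial (Some i) (partial (Some i) f) p =
    Complex (D (Some i) (D (Some i) (fun q => complex.Re (f q))) p)
            (D (Some i) (D (Some i) (fun q => complex.Im (f q))) p) by [].
rewrite /laplacian (eq_bigr _ (fun i _ => E i)).
rewrite sum_Complex.
by rewrite /lap; congr Complex; rewrite fct_sumE.
Qed.

Lemma schrodingerE f p : ('i * dt f p + laplacian f p)%C =
  Complex (lap (fun q => complex.Re (f q)) p - D None (fun q => complex.Im (f q)) p)
          (lap (fun q => complex.Im (f q)) p + D None (fun q => complex.Re (f q)) p).
Proof.
have -> : dt f p = Complex (D None (fun q => complex.Re (f q)) p)
                          (D None (fun q => complex.Im (f q)) p) by [].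
rewrite laplacianE.
move: (lap _ p) (lap _ p) (D _ _ p) (D _ _ p) => x y z t.
by apply/eqP; rewrite eq_complex /=; apply/andP; split; apply/eqP; ring.
Qed.

End complex_parts.

(** * The inequality *)

Lemma sqrt_sum_le (R : realType) (b x y z : R) : 0 < b ->
  4 * b ^+ 2 * x <= z -> 4 * b * y <= z ->
  b * Num.sqrt x + Num.sqrt b * Num.sqrt y <= Num.sqrt z.
Proof.
move=> b0 xz yz.
have half t : 4 * t <= z -> Num.sqrt t <= Num.sqrt z / 2.
  move=> tz; have h : Num.sqrt t <= Num.sqrt ((2^-1) ^+ 2 * z).
    by apply: ler_wsqrtr; lra.
  apply: (le_trans h).
  by rewrite sqrtrM ?sqr_ge0// sqrtr_sqr ger0_norm ?invr_ge0// mulrC.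
have -> : b * Num.sqrt x = Num.sqrt (b ^+ 2 * x).
  by rewrite sqrtrM ?sqr_ge0// sqrtr_sqr gtr0_norm.
rewrite -(sqrtrM _ (ltW b0)).
have h1 : Num.sqrt (b ^+ 2 * x) <= Num.sqrt z / 2 by apply: half; rewrite mulrA.
have h2 : Num.sqrt (b * y) <= Num.sqrt z / 2 by apply: half; rewrite mulrA.
by rewrite [leRHS]splitr lerD.
Qed.

Local Open Scope complex_scope.

Theorem proposition2p1 (R : realType) (n : nat) (beta c : R)
    (f : 'rV[R]_n * R -> R[i]) :
  (1 <= n)%N -> 0 < beta -> test_function f ->
  let w (p : 'rV[R]_n * R) := expR (beta * (c * p.2 + sqnorm p.1)) in
  (beta%:E * L2norm (fun p => ((w p)%:C * f p)%R)
   + (beta `^ 2^-1)%R%:E * L2norm (fun p => ((w p)%:C * (grad_norm f p)%:C)%R)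
   <= L2norm (fun p => ((w p)%:C * ('i%C * dt f p + laplacian f p))%R))%E.
Proof.
move=> n0 b0 [[sfr sfi] Kc]; cbv zeta.
set K := closure _ in Kc; have Kcl : closed K by exact: closed_closure.
set fr := (fun p => complex.Re (f p)) in sfr; set fi := (fun p => complex.Im (f p)) in sfi.
have wE p := esym (weightE beta c p).
have f0 p : ~ K p -> f p = 0.
  by move=> Kp; apply/eqP/negPn/negP => fp; apply: Kp; exact: subset_closure.
pose u := weight beta c * fr; pose v := weight beta c * fi.
have sW := @smooth_weight R n beta c.
have tu : testR K u.
  by split; [exact: smooth_mul sW sfr|move=> p /f0; rewrite /u fctE /fr => ->; exact: mulr0].
have tv : testR K v.
  by split; [exact: smooth_mul sW sfi|move=> p /f0; rewrite /v fctE /fi => ->; exact: mulr0].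
have [H1 H2] := carleman Kc Kcl c b0 n0 tu tv.
have reE : conj_re beta c u v = weight beta c * (lap fr - D None fi).
  rewrite mulrBr (weight_lap _ _ sfr) (weight_Dt _ _ sfi) /conj_re -/u -/v.
  move: (lap u) (D None v) (dil u) (cst (4 * _)) (cst (- 4 * _)) (cst (beta * c)) => *.
  by move: (@r2 R n) u v {H1 H2 tu tv} => *; ring.
have imE : conj_im beta c u v = weight beta c * (lap fi + D None fr).
  rewrite mulrDr (weight_lap _ _ sfi) (weight_Dt _ _ sfr) /conj_im -/u -/v.
  move: (lap v) (D None u) (dil v) (cst (4 * _)) (cst (- 4 * _)) (cst (beta * c)) => *.
  by move: (@r2 R n) u v {H1 H2 tu tv reE} => *; ring.
have tsq a : testR K a -> testR K (a * a) by move=> ta; exact: test_mull ta (proj1 ta).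
rewrite (L2norm_sqrt_Int (h := u * u + v * v) Kc).
- rewrite (L2norm_sqrt_Int (h := conj_grad2 beta u + conj_grad2 beta v) Kc).
  + rewrite (L2norm_sqrt_Int (h := conj_re beta c u v * conj_re beta c u v +
                            conj_im beta c u v * conj_im beta c u v) Kc).
    * by rewrite -!EFinM -EFinD lee_fin (powR12_sqrt (ltW b0)); exact: sqrt_sum_le.
    * by apply: test_add; apply: tsq; [exact: test_conj_re|exact: test_conj_im].
    * move=> p; rewrite wE schrodingerE real_mul_Complex sqr_normc reE imE.
      move: (lap fr) (lap fi) (D None fr) (D None fi) (weight beta c) => *.
      by rewrite !expr2.
  + by apply: test_add; exact: test_conj_grad2.
  + move=> p; rewrite wE.
    have -> : (grad_norm f p)%:C%C = Complex (grad_norm f p) 0 by [].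
    rewrite real_mul_Complex sqr_normc mulr0 expr0n addr0 exprMn.
    rewrite sqr_sqrtr; last by apply: sumr_ge0 => i _; exact: sqr_ge0.
    have E i : Normc.normc (partial (Some i) f p) ^+ 2 =
        D (Some i) fr p ^+ 2 + D (Some i) fi p ^+ 2 by exact: sqr_normc.
    rewrite (eq_bigr _ (fun i _ => E i)) big_split mulrDr /= /conj_grad2.
    rewrite (eq_bigr (fun i => (weight beta c * D (Some i) fr) *
      (weight beta c * D (Some i) fr))) => [|i _]; last by rewrite (weight_D _ _ _ sfr).
    rewrite [X in _ = (_ + X) p](eq_bigr (fun i => (weight beta c * D (Some i) fi) *
      (weight beta c * D (Some i) fi))) => [|i _]; last by rewrite (weight_D _ _ _ sfi).
    rewrite fctE !fct_sumE !mulr_sumr.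
    by congr (_ + _); apply: eq_bigr => i _; rewrite !fctE -exprMn expr2.
- exact: (test_add (tsq _ tu) (tsq _ tv)).
- move=> p; rewrite wE (_ : f p = Complex (fr p) (fi p)); last by rewrite /fr /fi; case: (f p).
  by rewrite real_mul_Complex sqr_normc !expr2.
Qed.
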